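(* Let $p_k>1$ for $k=1,2,\dots,n$ with $\sum_{k=1}^n \frac1{p_k}=1$ and let $x_k\ge 0$. Let $u,v>0$. Write $\Gamma_{CZ}=\Gamma_{CZ:(c,u,v)}$. Then for all integers $m\ge 2$, $$ \Gamma_{CZ}\Big(\sum_{k=1}^n\frac{1}{p_k}x_k\Big)+n r_0^m\prod_{k=1}^n\Gamma_{CZ}(x_k)^{\frac1{p_k}}\Big(1-\prod_{k=1}^n\Gamma_{CZ}(x_k)^{-\frac1n}\;\Gamma_{CZ}\Big(\sum_{k=1}^n\frac{1}{n}x_k\Big)\Big) $$ $$ \le \sum_{(i_1,\dots,i_{n-1})\in A} C_A\,\frac{1}{p_1^{i_0-i_1}\cdots p_n^{i_{n-1}-i_n}}\prod_{k=1}^n\Gamma_{CZ}(x_k)^{1-\frac{i_k-i_{k-1}}{m}}\;\Gamma_{CZ}\Big(\sum_{k=1}^n\frac{(i_k-i_{k-1})x_k}{m}\Big) \le \prod_{k=1}^n\Gamma_{CZ}(x_k)^{\frac1{p_k}}, $$ where $r_0=\min\{\frac1{p_k}: k=1,\dots,n\}$.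
   Context: For $c,u,v>0$, the extended Chaudhary-Zubair gamma function is defined for $x>0$ by $\Gamma_{CZ:(c,u,v)}(x)=\int_0^\infty t^{x-1}\exp\big(-\frac{t^v}{u}-\frac{c}{t^v/u}\big)\,dt$. Given $n$ and $m$, set $i_0:=m$, $i_n:=0$, and $A:=\{(i_1,\dots,i_{n-1}): 0\le i_k\le i_{k-1},\ 1\le k\le n-1\}$ (the $i_k$ being integers); for $(i_1,\dots,i_{n-1})\in A$, $C_A:=\binom{i_1}{i_2}\cdots\binom{i_{n-2}}{i_{n-1}}$, a product of binomial coefficients.
   Formalization: In the middle sum, C_A gains the factor binom(i_0,i_1); the exponent of Γ_CZ(x_k) is 1/p_k-(i_{k-1}-i_k)/m; the last argument is Σ(i_{k-1}-i_k)x_k/m. As printed the claim fails for n=m=2, p=(2,2), x=(0,0). Also c>0, as in the definition. *)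

(* Defs.v *)
From HB Require Import structures.
From mathcomp Require Import all_boot all_order all_algebra.
From mathcomp Require Import all_classical all_reals all_analysis.
Set Implicit Arguments.
Unset Strict Implicit.
Unset Printing Implicit Defensive.
Import Order.TTheory GRing.Theory Num.Theory.
Import numFieldNormedType.Exports.
Local Open Scope ring_scope.

(* For c, u, v > 0 the integral is finite and positive for every real x (the
   term c / (t^v / u) tames the integrand at 0), so the real-valued integral
   applies for x = 0 as well as for x > 0. *)
Definition Gamma_CZ (R : realType) (c u v x : R) : R :=
  \int[@lebesgue_measure R]_(t in `]0, +oo[%classic)
     (t `^ (x - 1) * expR (- (t `^ v / u) - c / (t `^ v / u))).

(* A tuple s encodes (i_1, ..., i_(n-1)), where 0 <= i_k <= m is forced by
   0 <= i_k <= i_(k-1) and i_0 = m.  [level s k] is i_k for 0 <= k <= n: the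
   head of the list is i_0 = m, and the default value 0 of nth gives i_n = 0. *)
Definition level (n m : nat) (s : n.-1.-tuple 'I_m.+1) (k : nat) : nat :=
  nth 0%N (m :: [seq val j | j <- s]) k.

Definition chains (n m : nat) : {set n.-1.-tuple 'I_m.+1} :=
  [set s | [forall k : 'I_n.-1, (level s k.+1 <= level s k)%N]].

(* 'C(i_0, i_1) * 'C(i_1, i_2) * ... * 'C(i_(n-2), i_(n-1)): the multinomial
   coefficient of the exponents i_(k-1) - i_k, including the factor
   'C(i_0, i_1) = 'C(m, i_1). *)
Definition chain_coef (n m : nat) (s : n.-1.-tuple 'I_m.+1) : nat :=
  (\prod_(k < n.-1) 'C(level s k, level s k.+1))%N.

(* For 'I_n, whose elements are 0, ..., n-1, the index k : 'I_n stands for the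
   1-based index k + 1, so this is i_(k-1) - i_k in 1-based notation. *)
Definition drop_at (R : realType) (n m : nat) (s : n.-1.-tuple 'I_m.+1)
    (k : 'I_n) : R :=
  (level s k)%:R - (level s k.+1)%:R.

(* The neutral value 1 does not affect the minimum when n > 0 and all p k > 1. *)
Definition min_inv (R : realType) (n : nat) (p : 'I_n -> R) : R :=
  \big[Num.min/1]_(k < n) (p k)^-1.

(* Main.v *)
Require Import Defs.
From HB Require Import structures.
From mathcomp Require Import all_boot all_order all_algebra.
From mathcomp Require Import all_classical all_reals all_analysis.
From mathcomp Require Import measurable_realfun ring lra.
Import Order.TTheory GRing.Theory Num.Theory.
Import numFieldNormedType.Exports.
Local Open Scope ring_scope.

(* With G = Gamma_CZ, put F(al) = prod_k G(x_k)^(- al_k) * G(sum_k al_k x_k) on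
   the simplex of exponents al.  F is convex, being an integral of exponentials
   of affine functions of al, and F = 1 at the vertices.  Divided by
   prod_k G(x_k)^(1/p_k), the middle term is the mean of F over the points
   (i_(k-1) - i_k)/m for the multinomial weights of (sum_k 1/p_k)^m, whose
   barycenter is (1/p_k)_k.  Convexity gives the upper bound 1.  For the lower
   bound, the vertex e_k has weight p_k^(-m) >= r_0^m: moving a mass r_0^m from
   each vertex to the point (1/n, ..., 1/n) preserves the barycenter, and
   Jensen's inequality applies to the new weights. *)

(** * Multinomial theorem and first moments over chains *)

(** Induction on [l]: the first entry [j] comes from the binomial expansion of [y 0] plus the rest,
    and the rest restarts from [j]. The bound [M] is kept apart from the start [i] so that the index
    type survives the restart. *)
Lemma multinomial_tuples (A : comNzRingType) (M l i : nat) (y : nat -> A) :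
  (i <= M)%N ->
  \sum_(s : l.-tuple 'I_M.+1)
    (\prod_(k < l) 'C(nth 0%N (i :: map val s) k,
                      nth 0%N (i :: map val s) k.+1))%:R
    * \prod_(k < l.+1)
        y k ^+ (nth 0 (i :: map val s) k - nth 0 (i :: map val s) k.+1)%N
  = (\sum_(k < l.+1) y k) ^+ i.
Proof.
elim: l i y => [|l IHl] i y iM.
  rewrite (big_pred1 [tuple]) => [|s]; last by rewrite [s]tuple0 /= eqxx.
  by rewrite !big_ord0 !big_ord1 mul1r subn0.
pose f (jt : 'I_M.+1 * l.-tuple 'I_M.+1) : l.+1.-tuple 'I_M.+1 :=
  cons_tuple jt.1 jt.2.
rewrite (reindex f) /=; last first.
  exists (fun s => (thead s, behead_tuple s)) => [[j t] _|s _].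
    by congr pair; exact: val_inj.
  by rewrite /f /= [RHS]tuple_eta.
pose F (j : 'I_M.+1) (t : l.-tuple 'I_M.+1) :=
  ('C(i, val j))%:R * y 0%N ^+ (i - j) *
  ((\prod_(k < l) 'C(nth 0%N (val j :: map val t) k,
                     nth 0%N (val j :: map val t) k.+1))%:R *
   \prod_(k < l.+1) y k.+1 ^+ (nth 0 (val j :: map val t) k
                               - nth 0 (val j :: map val t) k.+1)%N).
transitivity (\sum_(j : 'I_M.+1) \sum_(t : l.-tuple 'I_M.+1) F j t).
  rewrite pair_bigA; apply: eq_bigr => -[j t] _ /=.
  rewrite big_ord_recl [X in _ * X]big_ord_recl /= natrM /F.
  by rewrite mulrACA.
rewrite [in RHS]big_ord_recl exprDn.
under eq_bigr => j _ do rewrite -mulr_sumr (IHl j (fun k => y k.+1)) ?leq_ord //.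
(* Entries [j > i] have ['C(i, j) = 0]; only the binomial range [j <= i] remains. *)
rewrite -(subnKC iM) -addSn big_split_ord /= [X in _ + X]big1 ?addr0.
  by apply: eq_bigr => j _; rewrite -mulrA mulr_natl.
by move=> j _; rewrite bin_small ?mul0r // ltn_addr.
Qed.

(** A tuple outside [chains] rises somewhere, which makes a binomial factor vanish. *)
Lemma multinomial_chains (A : comNzRingType) (n m : nat) (y : 'I_n -> A) :
  (0 < n)%N ->
  \sum_(s in chains n m)
    (chain_coef s)%:R * \prod_(k < n) y k ^+ (level s k - level s k.+1)%N
  = (\sum_(k < n) y k) ^+ m.
Proof.
case: n y => // l y _.
transitivity ((\sum_(k < l.+1) y (inord k)) ^+ m); last first.
  by congr (_ ^+ _); apply: eq_bigr => k _; rewrite inord_val.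
rewrite -(@multinomial_tuples _ m l m (fun k => y (inord k)) (leqnn m)).
rewrite [LHS]big_mkcond; apply: eq_bigr => s _; rewrite inE.
case: ifPn => [_|/forallPn[k]].
  by congr (_ * _); apply: eq_bigr => k _; rewrite inord_val.
rewrite -ltnNge => lt_k; rewrite (bigD1 k) //= [X in (X * _)%N]bin_small //.
by rewrite mul0n mul0r.
Qed.

Lemma mean_level_drop (R : comNzRingType) (n m : nat) (q : 'I_n -> R) (k : 'I_n) :
  \sum_j q j = 1 ->
  \sum_(s in chains n m)
    ((chain_coef s)%:R * \prod_(j < n) q j ^+ (level s j - level s j.+1)%N)
    * (level s k - level s k.+1)%:R
  = m%:R * q k.
Proof.
(* Weighting y_k = q_k 'X and y_j = q_j (j <> k) makes 'X count the k-th drop;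
   the first moment is then the derivative of the generating polynomial at 1. *)
move=> q1; pose y j : {poly R} := (q j)%:P * (if j == k then 'X else 1).
have n0 : (0 < n)%N by apply: leq_ltn_trans (ltn_ord k).
have /(congr1 (fun P : {poly R} => P^`().[1])) := @multinomial_chains _ n m y n0.
rewrite linear_sum horner_sum.
have -> : \sum_j y j = 1 + (q k)%:P * ('X - 1).
  rewrite (bigD1 k) //= {1}/y eqxx.
  under eq_bigr => j /negPf jk do rewrite /y jk mulr1.
  have -> : \sum_(j | j != k) (q j)%:P = 1 - (q k)%:P.
    by rewrite -rmorph_sum /= -polyC1 -q1 [in RHS](bigD1 k) //= polyCD; ring.
  by ring.
rewrite /= poly.deriv_exp !poly.derivE !(hornerE, hornerMn, horner_exp) subrr.
rewrite mulr0 addr0 expr1n mulr1 mulr_natl => <-.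
apply: eq_bigr => s _.
have -> : \prod_(j < n) y j ^+ (level s j - level s j.+1) =
   (\prod_(j < n) q j ^+ (level s j - level s j.+1))%:P
     * 'X ^+ (level s k - level s k.+1).
  under eq_bigr => j _ do rewrite exprMn -rmorphXn.
  rewrite big_split /= -rmorph_prod; congr (_ * _).
  rewrite (bigD1 k) //= eqxx big1 ?mulr1 // => j /negPf ->.
  by rewrite expr1n.
rewrite -mulrA !mulr_natl derivMn deriv_mulC derivXn.
by rewrite !(hornerE, hornerMn, hornerXn) expr1n.
Qed.

(** * Vertex chains and level drops *)

(** The levels are [m] up to index [k], then 0, so the whole drop happens at [k]. Tuple entry [i] is
    level [i + 1], hence the strict test [i < k]. *)
Definition vertex_chain (n m : nat) (k : 'I_n) : n.-1.-tuple 'I_m.+1 :=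
  [tuple if (i < k)%N then ord_max else ord0 | i < n.-1].

Lemma level_vertex_chain (n m : nat) (k : 'I_n) (j : nat) :
  level (vertex_chain n m k) j = if (j <= k)%N then m else 0%N.
Proof.
have sz : size (vertex_chain n m k) = n.-1 by rewrite size_tuple.
case: j => [//|j].
rewrite -[LHS]/(nth 0%N [seq val i | i <- vertex_chain n m k] j).
have [jn|nj] := ltnP j n.-1.
  rewrite (nth_map ord0) ?sz //.
  have := tnth_mktuple
    (fun i : 'I_n.-1 => if (i < k)%N then @ord_max m else ord0) (Ordinal jn).
  by rewrite (tnth_nth ord0) /= => ->; case: ifP.
rewrite nth_default; last by rewrite size_map sz.
rewrite ltnNge (leq_trans _ nj) // -ltnS prednK //.
by rewrite (leq_ltn_trans _ (ltn_ord k)).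
Qed.

(** Distinct vertices must give distinct chains, so that no chain loses the mass [r ^+ m] twice. *)
Lemma vertex_chain_inj (n m : nat) : (0 < m)%N -> injective (@vertex_chain n m).
Proof.
move=> m0; have le_of (j k : 'I_n) :
    vertex_chain n m j = vertex_chain n m k -> (k <= j)%N.
  move=> /(congr1 (fun s => level s k)); rewrite !level_vertex_chain leqnn.
  by case: leqP => // _ me; rewrite -me in m0.
by move=> j k e; apply/val_inj/eqP; rewrite eqn_leq !le_of.
Qed.

Lemma vertex_chain_chains (n m : nat) (k : 'I_n) :
  vertex_chain n m k \in chains n m.
Proof.
rewrite inE; apply/forallP => j; rewrite !level_vertex_chain.
by case: (ltnP j k) => [/ltnW ->|].
Qed.

Lemma chain_coef_vertex (n m : nat) (k : 'I_n) :
  chain_coef (vertex_chain n m k) = 1%N.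
Proof.
rewrite /chain_coef big1 // => j _; rewrite !level_vertex_chain.
by case: (ltnP j k) => [/ltnW ->|_]; rewrite ?binn ?bin0.
Qed.

Lemma vertex_chain_drop (n m : nat) (k j : 'I_n) :
  (level (vertex_chain n m k) j - level (vertex_chain n m k) j.+1)%N
  = (if j == k then m else 0)%N.
Proof.
rewrite !level_vertex_chain -val_eqE /=.
by case: ltngtP; rewrite ?subn0 ?subnn.
Qed.

(** [chains] constrains the first [n.-1] steps; the last one descends to the default value 0. *)
Lemma level_le (n m : nat) (s : n.-1.-tuple 'I_m.+1) (k : 'I_n) :
  s \in chains n m -> (level s k.+1 <= level s k)%N.
Proof.
rewrite inE => /forallP h; case: n s k h => [|l] s [k /= kn] h //.
have [kl|lk] := ltnP k l; first exact: (h (Ordinal kl)).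
by rewrite {1}/level /= nth_default ?size_map ?size_tuple.
Qed.

Lemma drop_atE (R : realType) (n m : nat) (s : n.-1.-tuple 'I_m.+1) (k : 'I_n) :
  s \in chains n m -> drop_at R s k = (level s k - level s k.+1)%:R.
Proof. by move=> sC; rewrite /drop_at natrB ?level_le. Qed.

Lemma sum_drop_at (R : realType) (n m : nat) (s : n.-1.-tuple 'I_m.+1) :
  (0 < n)%N -> \sum_(k < n) drop_at R s k = m%:R.
Proof.
case: n s => // l s _; rewrite /drop_at.
rewrite -(big_mkord predT (fun k => (level s k)%:R - (level s k.+1)%:R)).
under eq_bigr do rewrite -opprB.
rewrite sumrN telescope_sumr // opprB /level /= nth_default ?subr0 //.
by rewrite size_map size_tuple.
Qed.

(** * Finite sums of integrals and Jensen's inequality for the exponential *)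

Lemma Rintegral_sum d (T : measurableType d) (R : realType)
    (mu : {measure set T -> \bar R}) (D : set T) (I : Type) (s : seq I)
    (f : I -> T -> R) :
  measurable D -> (forall i, mu.-integrable D (EFin \o f i)) ->
  \int[mu]_(t in D) (\sum_(i <- s) f i t) = \sum_(i <- s) \int[mu]_(t in D) f i t.
Proof.
move=> mD intf; elim: s => [|i s IHs].
  rewrite big_nil; under eq_Rintegral do rewrite big_nil.
  by rewrite /Rintegral integral0.
rewrite big_cons -IHs -RintegralD //.
  by apply: eq_Rintegral => t _; rewrite big_cons.
have -> : EFin \o (fun t => \sum_(j <- s) f j t) =
          (fun t => \sum_(j <- s) (EFin \o f j) t)%E.
  by apply/funext => t /=; rewrite sumEFin.
exact: integrable_sum.
Qed.

(** The graph of [expR] lies above its tangent at the barycenter [b]; averaging the tangent bound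
    cancels the linear term. *)
Lemma expR_jensen (R : realType) (I : finType) (w a : I -> R) :
  (forall i, 0 <= w i) -> \sum_i w i = 1 ->
  expR (\sum_i w i * a i) <= \sum_i w i * expR (a i).
Proof.
move=> w0 w1; set b := \sum_i w i * a i.
have -> : expR b = \sum_i w i * (expR b * (1 + (a i - b))).
  rewrite (eq_bigr (fun i => expR b * (w i * (1 - b) + w i * a i))) => [|i _].
    by rewrite -mulr_sumr big_split /= -mulr_suml w1 -/b; ring.
  by ring.
apply: ler_sum => i _; apply: ler_wpM2l => //.
have -> : expR (a i) = expR b * expR (a i - b) by rewrite -expRD addrC subrK.
by rewrite ler_wpM2l ?expR_ge0 ?expR_ge1Dx.
Qed.

(** * Integrability, positivity and convexity of the gamma integral *)

Definition CZ_integrand {R : realType} (c u v x t : R) : R :=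
  t `^ (x - 1) * expR (- (t `^ v / u) - c / (t `^ v / u)).

(** Square the bound [1 + y / 2 <= expR (y / 2)]. *)
Lemma sqr_le_expR (R : realType) (y : R) : 0 <= y -> y ^+ 2 / 4 <= expR y.
Proof.
move=> y0; have -> : y = y / 2 + y / 2 by field.
rewrite expRD; have := expR_ge1Dx (y / 2); nra.
Qed.

Section GammaCZ.
Context {R : realType} {c u v : R} (hc : 0 < c) (hu : 0 < u) (hv : 0 < v).

Local Notation mu := (@lebesgue_measure R).
Local Notation D := (`]0, +oo[%classic : set R).

Local Notation f := (CZ_integrand c u v).

(** With [L = ln t] the right side is [expR (v * L) / u + c * u * expR (- v * L)]. According to the
    sign of [L], one of the two terms has a nonnegative exponent and is bounded below through
    [sqr_le_expR]; [d] takes the smaller coefficient. *)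
Lemma sqr_ln_le_CZ_exponent : exists2 d : R, 0 < d &
  forall t, 0 < t -> d * ln t ^+ 2 <= t `^ v / u + c / (t `^ v / u).
Proof.
exists (Num.min u^-1 (c * u) * (v ^+ 2 / 4)).
  by rewrite mulr_gt0 ?divr_gt0 ?exprn_gt0 // lt_min invr_gt0 hu mulr_gt0.
move=> t t0; rewrite /powR gt_eqF //; set L := ln t.
have -> : c / (expR (v * L) / u) = c * u * expR (v * - L).
  by rewrite mulrN expRN invf_div mulrA.
rewrite [expR _ / u]mulrC -[leLHS]mulrA.
have m1 : Num.min u^-1 (c * u) <= u^-1 by rewrite ge_min lexx.
have m2 : Num.min u^-1 (c * u) <= c * u by rewrite ge_min lexx orbT.
have u0 : 0 <= u^-1 by rewrite invr_ge0 ltW.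
have cu0 : 0 <= c * u by rewrite ltW ?mulr_gt0.
have e1 := expR_ge0 (v * L); have e2 := expR_ge0 (v * - L).
have q0 : 0 <= v ^+ 2 / 4 * L ^+ 2 by rewrite mulr_ge0 ?divr_ge0 ?sqr_ge0.
have [L0|/ltW L0] := leP 0 L.
- have := sqr_le_expR _ _ (mulr_ge0 (ltW hv) L0); rewrite exprMn mulrAC => le1.
  apply: le_trans (ler_wpM2r q0 m1) _.
  by apply: le_trans (ler_wpM2l u0 le1) _; rewrite lerDl mulr_ge0.
- have NL : 0 <= - L by rewrite oppr_ge0.
  have := sqr_le_expR _ _ (mulr_ge0 (ltW hv) NL).
  rewrite exprMn sqrrN mulrAC => le1.
  apply: le_trans (ler_wpM2r q0 m2) _.
  by apply: le_trans (ler_wpM2l cu0 le1) _; rewrite lerDr mulr_ge0.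
Qed.

Lemma Gamma_CZ_integrand_dominated (x : R) :
  exists K : R, forall t, 0 < t -> f x t <= K * (oneDsqr t)^-1.
Proof.
have [d d0 dP] := sqr_ln_le_CZ_exponent.
pose B a := expR (a ^+ 2 / (4 * d)).
exists (B (x - 1) + B (x + 1)) => t t0.
(* In L = ln t the integrand is at most exp (a L - d L^2), which is bounded;
   the exponents a = x - 1 and a = x + 1 together give the factor 1 + t^2. *)
have fE a : t `^ a * expR (- (t `^ v / u) - c / (t `^ v / u)) <= B a.
  rewrite {1}/powR gt_eqF // -expRD ler_expR.
  apply: (@le_trans _ _ (a * ln t - d * ln t ^+ 2)).
    by rewrite lerD2l -opprD lerN2 dP.
  rewrite ler_pdivlMr ?mulr_gt0 //.
  (* Completing the square: the maximum of [a * L - d * L ^+ 2] is [a ^+ 2 / (4 * d)]. *)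
  by have := sqr_ge0 (a - 2 * d * ln t); nra.
rewrite ler_pdivlMr ?(lt_le_trans _ (oneDsqr_ge1 t)) // /oneDsqr mulrDr mulr1.
apply: lerD; first exact: fE.
have -> : f x t * t ^+ 2 =
          t `^ (x + 1) * expR (- (t `^ v / u) - c / (t `^ v / u)).
  rewrite /CZ_integrand mulrAC -(powR_mulrn 2 (ltW t0)) -powRD;
    last by rewrite (gt_eqF t0) implybT.
  by congr (_ `^ _ * _); lra.
exact: fE.
Qed.

Lemma Gamma_CZ_integrand_measurable (x : R) : measurable_fun D (f x).
Proof.
apply: measurable_funTS; apply: measurable_funM; first exact: measurable_powR.
apply: measurableT_comp => //.
have m1 : measurable_fun [set: R] (fun t : R => t `^ v / u).
  by apply: measurable_funM => //; exact: measurable_powR.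
apply: measurable_funB; first exact: measurableT_comp.
under eq_fun => t do rewrite invf_div -powRN.
by do 2 apply: measurable_funM => //; exact: measurable_powR.
Qed.

(** The dominating function is a multiple of [1 / (1 + t ^+ 2)], whose integral over the half-line
    is finite. *)
Lemma Gamma_CZ_integrable (x : R) : mu.-integrable D (EFin \o f x).
Proof.
have [K KP] := Gamma_CZ_integrand_dominated x.
apply: (@le_integrable _ _ _ mu D _ _ (EFin \o (fun t => K * (oneDsqr t)^-1))) => //.
- by apply/measurable_EFinP; exact: Gamma_CZ_integrand_measurable.
- move=> t /=; rewrite in_itv /= andbT => t0; rewrite lee_fin.
  rewrite ger0_norm ?mulr_ge0 ?powR_ge0 ?expR_ge0 //.
  by apply: le_trans (KP t t0) _; exact: ler_norm.
- have -> : EFin \o (fun t => K * (oneDsqr t)^-1) =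
           (fun t => K%:E * ((oneDsqr t)^-1)%:E)%E by apply/funext.
  apply: integrableZl => //.
  apply: (@integrableS _ _ _ mu (`[0, +oo[%classic : set R)) => //.
    by apply: subset_itvr; rewrite bnd_simp.
  have mV : measurable_fun (`[0, +oo[%classic : set R) (fun t : R => (oneDsqr t)^-1).
    apply: measurable_funTS; apply: continuous_measurable_fun.
    exact: continuous_oneDsqrV.
  apply/integrableP; split; first exact/measurable_EFinP.
  under eq_integral => t _ do
    rewrite abse_EFin ger0_norm ?invr_ge0 ?(le_trans _ (oneDsqr_ge1 t)) //.
  by rewrite integral0y_oneDsqr ltry.
Qed.

(** If the integral of this positive function were 0, the integrand would vanish almost everywhere
    and the half-line would be a null set. *)
Lemma Gamma_CZ_gt0 (x : R) : 0 < Gamma_CZ c u v x.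
Proof.
have f_gt0 t : D t -> 0 < f x t.
  by rewrite /= in_itv /= andbT => t0; rewrite mulr_gt0 ?powR_gt0 ?expR_gt0.
have ge0 : 0 <= Gamma_CZ c u v x by apply: Rintegral_ge0 => t /f_gt0/ltW.
rewrite lt_neqAle ge0 andbT eq_sym; apply/negP => /eqP G0.
have : (\int[mu]_(t in D) `|(EFin \o f x) t| = 0)%E.
  under eq_integral => t /set_mem Dt do
    rewrite /= ger0_norm ?(ltW (f_gt0 _ Dt)) //.
  rewrite -[LHS]fineK; first by congr (_%:E); exact: G0.
  by apply: (integrable_fin_num _ (Gamma_CZ_integrable x)).
move/ae_eq_integral_abs => /(_ _) [] //.
  by apply/measurable_EFinP; exact: Gamma_CZ_integrand_measurable.
move=> N [mN N0 sub].
have : (mu D <= mu N)%E.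
  apply: le_measure; rewrite ?inE //.
  move=> t Dt; apply: sub => /= /(_ Dt) [] ft.
  by have := f_gt0 t Dt; rewrite ft ltxx.
by rewrite N0 lebesgue_measure_itv /= ltry.
Qed.

(** For fixed [t] the integrand times [expR a] is, up to a factor free of [a] and [y], the
    exponential of an affine function of [(a, y)]; [expR_jensen] is integrated over [t]. The
    parameter [a] will carry the logarithm of the normalising product in [F]. *)
Lemma Gamma_CZ_jensen (I : finType) (w a y : I -> R) :
  (forall i, 0 <= w i) -> \sum_i w i = 1 ->
  expR (\sum_i w i * a i) * Gamma_CZ c u v (\sum_i w i * y i)
  <= \sum_i w i * (expR (a i) * Gamma_CZ c u v (y i)).
Proof.
move=> w0 w1.
have intZ (k z : R) : mu.-integrable D (EFin \o (fun t => k * f z t)).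
  have -> : EFin \o (fun t => k * f z t) = (fun t => k%:E * (EFin \o f z) t)%E.
    by apply/funext.
  by apply: integrableZl => //; exact: Gamma_CZ_integrable.
under [leRHS]eq_bigr => i _ do rewrite mulrA -RintegralZl ?Gamma_CZ_integrable //.
rewrite -RintegralZl ?Gamma_CZ_integrable //.
rewrite -(@Rintegral_sum _ _ _ mu D _ _ (fun i t => w i * expR (a i) * f (y i) t)) //.
apply: le_Rintegral => //; first exact: intZ.
  have -> : EFin \o (fun t => \sum_i w i * expR (a i) * f (y i) t) =
            (fun t => \sum_i (w i * expR (a i) * f (y i) t)%:E)%E.
    by apply/funext => t /=; rewrite sumEFin.
  by apply: integrable_sum => // i _; exact: (intZ (w i * expR (a i)) (y i)).
move=> t /=; rewrite in_itv /= andbT => t0.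
rewrite /CZ_integrand !mulrA; under [leRHS]eq_bigr do rewrite mulrA.
rewrite -mulr_suml ler_wpM2r ?expR_ge0 // /powR gt_eqF // -expRD.
under [leRHS]eq_bigr => i _ do rewrite -mulrA -expRD.
(* Total weight 1 lets the shift [- 1] move under the sum. *)
have -> : \sum_i w i * a i + (\sum_i w i * y i - 1) * ln t =
          \sum_i w i * (a i + (y i - 1) * ln t).
  rewrite -[in X in _ - X]w1 -sumrB mulr_suml -big_split /=.
  by apply: eq_bigr => i _; ring.
exact: expR_jensen.
Qed.

End GammaCZ.

(** * Jensen's inequality for multinomial weights *)

Definition finite_jensen {R : realType} {n : nat} (F : ('I_n -> R) -> R) : Prop :=
  forall (I : finType) (w : I -> R) (al : I -> 'I_n -> R),
    (forall i, 0 <= w i) -> \sum_i w i = 1 ->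
    F (fun k => \sum_i w i * al i k) <= \sum_i w i * F (al i).

(** The multinomial distribution with [m] trials and probabilities [q]. *)
Definition chain_weight {R : realType} {n m : nat} (q : 'I_n -> R)
    (s : n.-1.-tuple 'I_m.+1) : R :=
  (chain_coef s)%:R * \prod_(k < n) q k ^+ (level s k - level s k.+1)%N.

Definition chain_point {R : realType} {n m : nat} (s : n.-1.-tuple 'I_m.+1)
    (k : 'I_n) : R :=
  drop_at R s k / m%:R.

Section MultinomialJensen.
Context {R : realType} {n m : nat} (q : 'I_n -> R) (F : ('I_n -> R) -> R).
Context (m0 : (0 < m)%N) (q0 : forall k, 0 <= q k) (q1 : \sum_k q k = 1).
Context (F_jensen : finite_jensen F).
Context (F_vertex : forall k, F (fun j => (j == k)%:R) = 1).

Local Notation W := (@chain_weight R n m q).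
Local Notation point := (@chain_point R n m).

Let n0 : (0 < n)%N.
Proof.
rewrite lt0n; apply/eqP => n0; move: q1; rewrite big1 => [/eqP|[i ilt] _].
  by rewrite eq_sym oner_eq0.
by exfalso; rewrite n0 in ilt.
Qed.

Let mR : m%:R != 0 :> R. Proof. by rewrite pnatr_eq0 -lt0n. Qed.

Let W_ge0 s : 0 <= W s.
Proof. by rewrite mulr_ge0 // prodr_ge0 // => k _; rewrite exprn_ge0. Qed.

Let sum_W : \sum_(s in chains n m) W s = 1.
Proof. by rewrite multinomial_chains // q1 expr1n. Qed.

Let point_vertex k : point (vertex_chain n m k) = (fun j => (j == k)%:R).
Proof.
apply/funext => j; rewrite /chain_point drop_atE ?vertex_chain_chains //.
by rewrite vertex_chain_drop; case: eqP => _; rewrite ?mul0r ?divff.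
Qed.

Let W_vertex k : W (vertex_chain n m k) = q k ^+ m.
Proof.
rewrite /chain_weight chain_coef_vertex mul1r (bigD1 k) //= vertex_chain_drop eqxx.
by rewrite big1 ?mulr1 // => j /negPf jk; rewrite vertex_chain_drop jk expr0.
Qed.

(** Each point is a convex combination of the vertices, with its own coordinates as weights, so [F]
    is at most 1 there. *)
Lemma multinomial_jensen_le1 :
  \sum_(s in chains n m) W s * F (point s) <= 1.
Proof.
rewrite -sum_W; apply: ler_sum => s sC; rewrite ler_piMr //.
have pt0 k : 0 <= point s k by rewrite /chain_point drop_atE ?divr_ge0.
have pt1 : \sum_k point s k = 1 by rewrite /chain_point -mulr_suml sum_drop_at ?divff.
have := F_jensen _ _ (fun k j => (j == k)%:R) pt0 pt1.
under [leRHS]eq_bigr => k _ do rewrite F_vertex mulr1.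
rewrite pt1; congr (F _ <= _); apply/funext => j.
rewrite (bigD1 j) //= eqxx mulr1 big1 ?addr0 // => k /negPf kj.
by rewrite eq_sym kj mulr0.
Qed.

(** In Jensen's bound for the redistributed weights, the vertices lose [n%:R * r ^+ m] in total, as
    [F = 1] there, and the center gains that mass times its value of [F]; rearranging gives the
    claim. *)
Lemma multinomial_jensen_ge (r : R) :
  0 <= r -> (forall k, r <= q k) ->
  F q + n%:R * r ^+ m * (1 - F (fun=> n%:R^-1))
  <= \sum_(s in chains n m) W s * F (point s).
Proof.
move=> r0 rq.
pose cut s : R := \sum_k r ^+ m * (s == vertex_chain n m k)%:R.
(* The [unit] summand indexes the center. The index type holds all tuples, so membership in [chains]
   enters as a 0-1 factor. *)
pose w (i : n.-1.-tuple 'I_m.+1 + unit) : R :=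
  if i is inl s then (s \in chains n m)%:R * W s - cut s else n%:R * r ^+ m.
pose split T (g : n.-1.-tuple 'I_m.+1 -> T) (h : T)
    (i : n.-1.-tuple 'I_m.+1 + unit) := if i is inl s then g s else h.
(* Used three times: for the total mass, for the coordinates of the barycenter, and for the values
   of [F]. *)
have sum_w g h : \sum_i w i * split R g h i =
    \sum_(s in chains n m) W s * g s - r ^+ m * \sum_k g (vertex_chain n m k)
    + n%:R * r ^+ m * h.
  rewrite big_sumType /= [X in _ + X](big_pred1 tt) => [|[]//].
  congr (_ + _); under eq_bigr do rewrite mulrBl.
  rewrite sumrB [in RHS]big_mkcond; congr (_ - _).
    by apply: eq_bigr => s _; case: ifP; rewrite ?mul1r // !mul0r.
  under [LHS]eq_bigr do rewrite mulr_suml.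
  rewrite exchange_big mulr_sumr; apply: eq_bigr => k _ /=.
  rewrite (bigD1 (vertex_chain n m k)) //= eqxx mulr1 big1 ?addr0 //.
  by move=> s /negPf ->; rewrite mulr0 mul0r.
have w_ge0 i : 0 <= w i.
  case: i => [s|[]] /=; last by rewrite mulr_ge0 ?exprn_ge0.
  rewrite subr_ge0 /cut.
  have [k /eqP sk|no] := pickP (fun k => s == vertex_chain n m k); last first.
    by rewrite big1 ?(mulr_ge0 _ (W_ge0 s)) // => k _; rewrite no mulr0.
  rewrite sk vertex_chain_chains mul1r W_vertex (bigD1 k) //= eqxx mulr1.
  rewrite big1 => [|j /negPf jk]; last first.
    by rewrite (inj_eq (@vertex_chain_inj n m m0)) eq_sym jk mulr0.
  by rewrite addr0 lerXn2r ?nnegrE.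
have w1 : \sum_i w i = 1.
  transitivity (\sum_i w i * split R (fun=> 1) 1 i).
    by apply: eq_bigr => -[s|[]] _; rewrite mulr1.
  rewrite sum_w sumr_const card_ord; under eq_bigr do rewrite mulr1.
  by rewrite sum_W mulr1 [_ * r ^+ m]mulrC mulr_natr subrK.
have := F_jensen _ _ (split _ point (fun=> n%:R^-1)) w_ge0 w1.
(* In coordinate [k] the chains average to [q k], the vertex [k] takes away [r ^+ m], and the center
   returns [n%:R * r ^+ m / n%:R]. *)
have -> : (fun k => \sum_i w i * split _ point (fun=> n%:R^-1) i k) = q.
  apply/funext => k.
  have := sum_w (fun s => point s k) n%:R^-1.
  rewrite (eq_bigr (fun i => w i * split _ point (fun=> n%:R^-1) i k)); last first.
    by case.
  move=> ->; under [X in X - _]eq_bigr => s sC do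
    rewrite /chain_point drop_atE // mulrA.
  rewrite -mulr_suml mean_level_drop // mulrAC mulfV // mul1r.
  rewrite (bigD1 k) //= point_vertex eqxx big1 => [|j /negPf jk]; last first.
    by rewrite point_vertex eq_sym jk.
  by rewrite addr0 mulr1 mulrAC mulfV ?pnatr_eq0 -?lt0n // mul1r subrK.
have := sum_w (fun s => F (point s)) (F (fun=> n%:R^-1)).
rewrite (eq_bigr (fun i => w i * F (split _ point (fun=> n%:R^-1) i))); last first.
  by case.
move=> ->; under [X in _ - _ * X]eq_bigr do rewrite point_vertex F_vertex.
by rewrite sumr_const card_ord; lra.
Qed.

End MultinomialJensen.

(** * Application to the gamma function *)

Theorem theorem7p1 (R : realType) (n : nat) (p x : 'I_n -> R) (c u v : R)
  (hp : forall k, 1 < p k)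
  (hsum : \sum_(k < n) (p k)^-1 = 1)
  (hx : forall k, 0 <= x k)
  (hc : 0 < c) (hu : 0 < u) (hv : 0 < v)
  (m : nat) (hm : (2 <= m)%N) :
  let G := Gamma_CZ c u v in
  let r0 := min_inv p in
  let middle :=
    \sum_(s in chains n m)
      (chain_coef s)%:R
      * (\prod_(k < n) p k ^+ (level s k - level s k.+1)%N)^-1
      * (\prod_(k < n) G (x k) `^ ((p k)^-1 - drop_at R s k / m%:R))
      * G (\sum_(k < n) drop_at R s k * x k / m%:R) in
  G (\sum_(k < n) (p k)^-1 * x k)
    + n%:R * r0 ^+ m * (\prod_(k < n) G (x k) `^ (p k)^-1)
      * (1 - (\prod_(k < n) G (x k) `^ (- n%:R^-1))
             * G (\sum_(k < n) n%:R^-1 * x k))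
    <= middle
  /\ middle <= \prod_(k < n) G (x k) `^ (p k)^-1.
Proof.
move=> G r0 middle.
have G_gt0 y : 0 < G y by exact: Gamma_CZ_gt0.
pose q k := (p k)^-1.
pose P := \prod_(k < n) G (x k) `^ q k.
(* The product of powers is written as one exponential, linear in [al] inside, to fit
   [Gamma_CZ_jensen]. *)
pose F (al : 'I_n -> R) :=
  expR (\sum_k al k * - ln (G (x k))) * G (\sum_k al k * x k).
have FE al : F al = (\prod_(k < n) G (x k) `^ (- al k)) * G (\sum_k al k * x k).
  rewrite /F expR_sum; congr (_ * _); apply: eq_bigr => k _.
  by rewrite /powR gt_eqF // mulrN mulNr.
have P_gt0 : 0 < P by apply: prodr_gt0 => k _; exact: powR_gt0.
(* Multiplying by [P] turns the exponents [- al k] into those of the middle term. *)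
have PF al : P * F al =
    (\prod_(k < n) G (x k) `^ (q k - al k)) * G (\sum_k al k * x k).
  rewrite FE mulrA -big_split /=; congr (_ * _); apply: eq_bigr => k _.
  by rewrite -powRD // (gt_eqF (G_gt0 _)) implybT.
have q0 k : 0 <= q k by rewrite invr_ge0 ltW // (lt_trans ltr01).
have F_jensen : finite_jensen F.
  move=> I w al w0 w1; rewrite /F.
  have swap (z : 'I_n -> R) : \sum_k (\sum_i w i * al i k) * z k =
      \sum_i w i * \sum_k al i k * z k.
    under [LHS]eq_bigr do rewrite mulr_suml.
    rewrite exchange_big; apply: eq_bigr => i _; rewrite mulr_sumr.
    by apply: eq_bigr => k _; rewrite mulrA.
  by rewrite !swap; exact: Gamma_CZ_jensen.
have F_vertex k : F (fun j => (j == k)%:R) = 1.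
  have pick (z : 'I_n -> R) : \sum_j (j == k)%:R * z j = z k.
    rewrite (bigD1 k) //= eqxx mul1r big1 ?addr0 // => j /negPf ->.
    by rewrite mul0r.
  by rewrite /F !pick expRN lnK ?posrE // mulVf // gt_eqF.
have m0 : (0 < m)%N by exact: ltnW.
have r0_ge0 : 0 <= r0 by apply: le_bigmin => // k _; exact: q0.
have r0_le k : r0 <= q k by exact: bigmin_le.
have middleE : middle = P * \sum_(s in chains n m) chain_weight q s * F (chain_point s).
  rewrite mulr_sumr; apply: eq_bigr => s _; rewrite mulrCA PF mulrA.
  congr (_ * _ * _ * _).
    by rewrite -prodfV; apply: eq_bigr => k _; rewrite exprVn.
  by congr G; apply: eq_bigr => k _; rewrite mulrAC.
have lo := multinomial_jensen_ge q F m0 q0 hsum F_jensen F_vertex r0 r0_ge0 r0_le.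
have hi := multinomial_jensen_le1 q F m0 q0 hsum F_jensen F_vertex.
rewrite middleE; split; last by rewrite -[leRHS]mulr1 ler_pM2l.
apply: le_trans (ler_wpM2l (ltW P_gt0) lo).
(* At [al = q] all exponents [q k - al k] vanish, so [P * F q] reduces to [G] at the weighted
   mean. *)
rewrite [leRHS]mulrDr PF [in leRHS]big1 ?mul1r => [|k _]; last by rewrite subrr powRr0.
by rewrite -FE lerD2l -/P [leRHS]mulrA [P * _]mulrC.
Qed.
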